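(* For every $m\ge 1$ let $w_m$ be the number of block-wise simple permutations in $\mathcal{S}_m$ and let $s_m$ be the number of simple permutations in $\mathcal{S}_m$. Then for every $n\ge 4$, $$w_n=\sum_{l=4}^{n}s_l\sum_{(\lambda_1,\dots,\lambda_l)\in \mathrm{Comp}(n,l)}w_{\lambda_1}\cdots w_{\lambda_l},$$ where $\mathrm{Comp}(n,l)$ is the set of compositions of $n$ into $l$ parts, i.e. of $l$-tuples of positive integers with sum $n$.
   Context: $\mathcal{S}_n$ is the set of permutations of $\{1,\dots,n\}$, written in one-line notation. An interval of $\pi=a_1\cdots a_n\in\mathcal{S}_n$ is a non-empty contiguous sequence of entries $a_ia_{i+1}\cdots a_{i+k}$ whose values form a set of consecutive integers. The whole permutation and the single entries are the trivial intervals; all others are proper. A permutation is simple if it has no proper intervals. Inflation: for $\sigma\in\mathcal{S}_k$ and $\alpha_i\in\mathcal{S}_{n_i}$ ($n_i\ge1$, $1\le i\le k$), $\sigma[\alpha_1,\dots,\alpha_k]\in\mathcal{S}_{n_1+\cdots+n_k}$ is the permutation obtained by replacing the $i$-th entry of $\sigma$, for each $i$, by a block of $n_i$ consecutive positions and consecutive values that is order-isomorphic to $\alpha_i$, the blocks being in the same relative order (in values) as the entries of $\sigma$. Example: $2413[213,21,132,1]=546\,98\,132\,7$. Block-wise simple permutations are defined recursively: (1) the permutation $1\in\mathcal{S}_1$ is block-wise simple; (2) $\pi\in\mathcal{S}_n$ is block-wise simple if there are a simple permutation $\sigma\in\mathcal{S}_k$ with $k\ge 4$ and block-wise simple permutations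 $\alpha_1,\dots,\alpha_k$ such that $\pi=\sigma[\alpha_1,\dots,\alpha_k]$. No other permutations are block-wise simple (in particular $w_1=1$, $w_2=w_3=0$). *)

(* Defs.v *)
From mathcomp Require Import all_boot all_order all_fingroup.
From mathcomp Require Import boolp.

Set Implicit Arguments.
Unset Strict Implicit.
Unset Printing Implicit Defensive.

(* Positions and values range over 'I_n = {0, ..., n - 1} instead of          *)
(* {1, ..., n}.                                                               *)

Definition consecutive n (A : {set 'I_n}) : bool :=
  [exists a : 'I_n, exists b : 'I_n, A == [set x : 'I_n | a <= x <= b]].

(* An interval of pi is represented by its set A of positions.                *)
Definition interval n (pi : 'S_n) (A : {set 'I_n}) : bool :=
  [&& A != set0, consecutive A & consecutive (pi @: A)].

Definition proper_interval n (pi : 'S_n) (A : {set 'I_n}) : bool :=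
  [&& interval pi A, A != setT & #|A| != 1].

Definition simple_perm n (pi : 'S_n) : bool :=
  [forall A : {set 'I_n}, ~~ proper_interval pi A].

Section Inflation.
Context {k : nat} (sigma : 'S_k) {m : 'I_k -> nat}.
Variable alpha : forall i : 'I_k, 'S_(m i).

(* The block replacing the i-th entry of sigma has its values above those of  *)
(* all the blocks i' with sigma i' < sigma i.                                 *)
Definition inflate_val (i : 'I_k) (j : 'I_(m i)) : nat :=
  \sum_(i' < k | sigma i' < sigma i) m i' + alpha i j.

Lemma inflate_val_block (i i0 : 'I_k) (j : 'I_(m i)) (j0 : 'I_(m i0)) :
  sigma i < sigma i0 -> inflate_val j < inflate_val j0.
Proof.
move=> lt_i; rewrite /inflate_val ltn_addr //.
rewrite (bigD1 (P := fun i' => sigma i' < sigma i0) i) //= addnC.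
rewrite -addSn leq_add ?ltn_ord //.
rewrite [leqRHS](bigID (fun i' : 'I_k => sigma i' < sigma i)) /=.
rewrite [leqLHS](eq_bigl (fun i' : 'I_k =>
  (sigma i' < sigma i0) && (i' != i) && (sigma i' < sigma i))) ?leq_addr //.
move=> i'; case: ltnP => lt_i'; last by rewrite andbF.
rewrite (ltn_trans lt_i' lt_i) andbT; apply/esym.
by apply: contraTneq lt_i' => ->; rewrite ltnn.
Qed.

Lemma inflate_val_lt (i : 'I_k) (j : 'I_(m i)) :
  inflate_val j < \sum_(i' < k) m i'.
Proof.
rewrite /inflate_val.
rewrite [ltnRHS](bigID (fun i' : 'I_k => sigma i' < sigma i)) /=.
rewrite ltn_add2l (bigD1 i) ?ltnn //=.
by rewrite ltn_addr ?ltn_ord.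
Qed.

(* tagnat.sig1 s is the block containing position s, and tagnat.sig2 s is the *)
(* position of s inside that block.                                           *)
Definition inflate_fun (s : 'I_(\sum_(i < k) m i)) : 'I_(\sum_(i < k) m i) :=
  Ordinal (inflate_val_lt (tagnat.sig2 s)).

Lemma inflate_fun_inj : injective inflate_fun.
Proof.
move=> s t /(congr1 val) /= eq_st.
rewrite -[s]tagnat.sig2K -[t]tagnat.sig2K.
move: (tagnat.sig1 s) (tagnat.sig2 s) (tagnat.sig1 t) (tagnat.sig2 t) eq_st.
move=> i j i0 j0.
case: (ltngtP (sigma i) (sigma i0)) => [lt_i|lt_i|/val_inj/perm_inj eq_i].
- by move=> e; have := inflate_val_block j j0 lt_i; rewrite e ltnn.
- by move=> e; have := inflate_val_block j0 j lt_i; rewrite e ltnn.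
- case: _ / eq_i in j0 *.
  by rewrite /inflate_val => /addnI/val_inj/perm_inj->.
Qed.

Definition inflate : 'S_(\sum_(i < k) m i) := perm inflate_fun_inj.

Lemma inflateE (i : 'I_k) (j : 'I_(m i)) :
  inflate (tagnat.Rank i j) = \sum_(i' < k | sigma i' < sigma i) m i' + alpha i j
    :> nat.
Proof.
rewrite permE /= -/(inflate_val j) /tagnat.sig2 /tagnat.sig1 /tagnat.Rank.
by rewrite tagnat.rankK.
Qed.

End Inflation.

Inductive blockwise_simple : forall n, 'S_n -> Prop :=
| BlockwiseSimple1 : blockwise_simple (1%g : 'S_1)
| BlockwiseSimpleInflate k (sigma : 'S_k) (m : 'I_k -> nat)
    (alpha : forall i : 'I_k, 'S_(m i)) :
    4 <= k -> simple_perm sigma ->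
    (forall i, 0 < m i) -> (forall i, blockwise_simple (alpha i)) ->
    blockwise_simple (inflate sigma alpha).

Definition num_simple (n : nat) : nat :=
  #|[set pi : 'S_n | simple_perm pi]|.

Definition num_blockwise_simple (n : nat) : nat :=
  #|[set pi : 'S_n | `[< blockwise_simple pi >]]|.

(* Each part of a composition of n is at most n, so the parts can be taken in *)
(* the finite type 'I_n.+1.                                                   *)
Definition Comp (n l : nat) : {set l.-tuple 'I_n.+1} :=
  [set lam : l.-tuple 'I_n.+1 |
     [forall i, 0 < tnth lam i] && (\sum_(i < l) tnth lam i == n)].

(* Main.v *)
(** An inflation [pi = sigma[alpha_1, ..., alpha_k]] with [sigma] simple and
[k >= 4] is determined by [pi]: every interval of [pi] other than the whole
permutation lies inside a single block, so two such decompositions have the same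
blocks, and then the same quotient [sigma] and the same [alpha_i]. Hence the
block-wise simple permutations of size [n >= 4] are the disjoint union, over [l],
the simple [sigma] of size [l] and the compositions of [n] into [l] parts, of the
sets of inflations of [sigma], each of cardinality a product of [w_{lambda_i}]. *)

Require Import Defs.
From mathcomp Require Import all_boot all_order all_fingroup.
From mathcomp Require Import boolp.

Set Implicit Arguments.
Unset Strict Implicit.
Unset Printing Implicit Defensive.

(** * Convex sets of positions and monotone maps onto blocks *)

Lemma consecutiveP n (A : {set 'I_n}) : A != set0 ->
  reflect {in A &, forall x z y : 'I_n, x <= y <= z -> y \in A} (consecutive A).
Proof.
move=> A0; apply: (iffP idP).
  move=> /existsP[a /existsP[b /eqP->]] x z; rewrite !inE.
  move=> /andP[ax _] /andP[_ zb] y /andP[xy yz].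
  by rewrite inE (leq_trans ax xy) (leq_trans yz zb).
case/set0Pn: A0 => x0 Ax0 cvxA; case: (arg_minnP (@nat_of_ord n) Ax0) => a Aa minA.
case: (arg_maxnP (@nat_of_ord n) Ax0) => b Ab maxA.
apply/existsP; exists a; apply/existsP; exists b; apply/eqP/setP=> y; rewrite inE.
apply/idP/idP => [Ay|]; last exact: cvxA.
by apply/andP; split; [exact: minA | exact: maxA].
Qed.

(* f cuts 'I_n into k consecutive non-empty blocks, numbered in order.        *)
Definition onto_mono n k (f : 'I_n -> 'I_k) : Prop :=
  (forall i, exists s, f s = i) /\ (forall s t, f s < f t -> s < t).

Section OntoMono.
Variables (n k : nat) (f : 'I_n -> 'I_k).
Hypothesis om_f : onto_mono f.

Lemma consecutive_imset (A : {set 'I_n}) :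
  A != set0 -> consecutive A -> consecutive (f @: A).
Proof.
case: om_f => onto_f mono_f A0 /(consecutiveP A0) cvxA.
have fA0 : f @: A != set0 by rewrite -card_gt0 card_gt0 imset_eq0.
apply/(consecutiveP fA0) => _ _ /imsetP[x Ax ->] /imsetP[z Az ->] y.
rewrite leq_eqVlt => /andP[/orP[/eqP/val_inj<-|lt_xy]]; first by rewrite imset_f.
rewrite leq_eqVlt => /orP[/eqP/val_inj->|lt_yz]; first by rewrite imset_f.
have [t ft] := onto_f y; rewrite -ft in lt_xy lt_yz *.
apply: imset_f; apply: (cvxA x z) => //.
by apply/andP; split; apply/ltnW/mono_f.
Qed.

Lemma consecutive_fiber i : consecutive [set s | f s == i].
Proof.
case: om_f => onto_f mono_f.
have F0 : [set s | f s == i] != set0.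
  by have [s fs] := onto_f i; apply/set0Pn; exists s; rewrite inE fs.
apply/(consecutiveP F0) => x z; rewrite !inE => /eqP fx /eqP fz y /andP[xy yz].
rewrite inE -val_eqE /=.
case: (ltngtP (f y) i) => //; rewrite -{1}fx -?fz.
  by move=> /mono_f; rewrite ltnNge xy.
by rewrite fx -fz => /mono_f; rewrite ltnNge yz.
Qed.

(** Since [A] meets every block, blocks on both sides of that of [x] would squeeze [x] into [A] by
    convexity; so [f x] is the first or the last index. *)
Lemma consecutive_setC1 (A : {set 'I_n}) x :
  1 < k -> consecutive A -> f @: A = setT -> x \notin A ->
  consecutive [set~ f x].
Proof.
case: om_f => onto_f mono_f k1 cA fA xA.
have A0 : A != set0.
  apply: contra_eq_neq fA => ->; rewrite imset0 eq_sym.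
  by apply/set0Pn; exists (f x).
have C0 : [set~ f x] != set0.
  by rewrite -card_gt0 cardsC1 card_ord -ltnS prednK // ltnW.
move/(consecutiveP A0): cA => cvxA.
apply/(consecutiveP C0) => i j; rewrite !inE => ix jx y /andP[iy yj].
rewrite !inE; apply: contraNneq xA => yx; subst y.
have lt_ix : i < f x by rewrite ltn_neqAle iy andbT.
have lt_xj : f x < j by rewrite ltn_neqAle yj andbT eq_sym.
have /imsetP[s As si] : i \in f @: A by rewrite fA inE.
have /imsetP[t At tj] : j \in f @: A by rewrite fA inE.
apply: (cvxA s t) => //.
by apply/andP; split; apply/ltnW/mono_f; rewrite -?si -?tj.
Qed.

End OntoMono.

(** All values below [f s] are attained by [f], and [g] increases strictly along their preimages. *)
Lemma onto_refine_leq n k l (f : 'I_n -> 'I_k) (g : 'I_n -> 'I_l) :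
  (forall i, exists s, f s = i) ->
  (forall s t, f s < f t -> g s < g t) -> forall s, f s <= g s.
Proof.
move=> onto_f fg s; move: {2}(nat_of_ord (f s)) (erefl (nat_of_ord (f s))) => r.
elim: r s => [|r IHr] s fs; first by rewrite fs.
have rk : r < k by rewrite ltnW // -fs.
have [t ft] := onto_f (Ordinal rk).
rewrite fs; apply: leq_ltn_trans (fg t s _); last by rewrite ft fs.
by rewrite -[leqLHS]/(val (Ordinal rk)) -ft; apply: IHr; rewrite ft.
Qed.

(** * Block decompositions of a permutation and its intervals *)

(** This says that [pi] inflates [sigma] with the fibres of [b] as blocks, without naming the
    dependent family [alpha]. *)
Definition block_map n k (pi : 'S_n) (sigma : 'S_k) (b : 'I_n -> 'I_k) : Prop :=
  onto_mono b /\ (forall s t, sigma (b s) < sigma (b t) -> pi s < pi t).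

Section BlockMap.
Variables (n k : nat) (pi : 'S_n) (sigma : 'S_k) (b : 'I_n -> 'I_k).
Hypothesis bm : block_map pi sigma b.

(** The same blocks read on values: facts about sets of positions then also apply to [pi @: A]. *)
Lemma block_map_values : onto_mono (fun v => sigma (b ((pi^-1)%g v))).
Proof.
case: bm => -[onto_b _] mono_pi; split=> [i|v w /mono_pi]; last by rewrite !permKV.
have [s bs] := onto_b ((sigma^-1)%g i).
by exists (pi s); rewrite permK bs permKV.
Qed.

Lemma interval_fiber i : interval pi [set s | b s == i].
Proof.
case: (bm) => -[onto_b mono_b] _; apply/and3P; split.
- by have [s bs] := onto_b i; apply/set0Pn; exists s; rewrite inE bs.
- exact: consecutive_fiber.
- suff -> : pi @: [set s | b s == i] =
            [set v | sigma (b ((pi^-1)%g v)) == sigma i].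
    exact: (consecutive_fiber block_map_values).
  apply/setP=> v; rewrite inE (inj_eq perm_inj); apply/imsetP/idP.
    by move=> [s]; rewrite inE => bs ->; rewrite permK.
  by move=> bv; exists ((pi^-1)%g v); rewrite ?inE ?permKV.
Qed.

(* The blocks met by an interval form an interval of sigma.  If they are all  *)
(* the blocks, a missing position can only lie in a block extremal both in    *)
(* position and in value, and removing that entry from sigma would leave a    *)
(* proper interval.                                                           *)
Lemma interval_sub_block (A : {set 'I_n}) :
  3 < k -> simple_perm sigma -> interval pi A -> A != setT ->
  {in A &, forall s t, b s = b t}.
Proof.
move=> k3 /forallP simple_s /and3P[A0 cA cpA] AT.
have imE : sigma @: (b @: A) = (fun v => sigma (b ((pi^-1)%g v))) @: (pi @: A).
  by rewrite -!imset_comp; apply: eq_imset => s; rewrite /= permK.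
have pA0 : pi @: A != set0 by rewrite imset_eq0.
have intB : interval sigma (b @: A).
  rewrite /interval imset_eq0 A0 (consecutive_imset (proj1 bm)) //=.
  by rewrite imE (consecutive_imset block_map_values).
have /negP := simple_s (b @: A); rewrite /proper_interval intB /=.
have [BT _|BT] := eqVneq (b @: A) setT; last first.
  case: eqP => // /eqP/cards1P[i Bi] _ s t As At.
  have /set1P-> : b s \in [set i] by rewrite -Bi imset_f.
  by have /set1P-> : b t \in [set i] by rewrite -Bi imset_f.
have [x xA] : exists x, x \notin A.
  by move: AT; rewrite -subTset => /subsetPn[x _ xA]; exists x.
have k1 : 1 < k by rewrite (leq_trans _ k3).
have c1 := consecutive_setC1 (proj1 bm) k1 cA BT xA.
have c2 : consecutive [set~ sigma (b x)].
  have := consecutive_setC1 block_map_values (A := pi @: A) (x := pi x) k1 cpA.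
  rewrite -imE BT permK mem_imset; last exact: perm_inj.
  apply=> //; apply/setP=> v; rewrite inE; apply/imsetP.
  by exists ((sigma^-1)%g v); rewrite ?permKV.
(* This set has [k - 1 > 1] elements and misses [b x], so it is a proper interval. *)
have /negP[] := simple_s [set~ b x]; rewrite /proper_interval /interval c1.
have cC : #|[set~ b x]| = k.-1 by rewrite cardsC1 card_ord.
have -> : sigma @: [set~ b x] = [set~ sigma (b x)].
  apply/setP=> v; rewrite !inE; apply/imsetP/idP.
    by move=> [i]; rewrite !inE => ix ->; rewrite (inj_eq perm_inj).
  move=> vx; exists ((sigma^-1)%g v); rewrite ?permKV // !inE.
  by apply: contra vx => /eqP<-; rewrite permKV.
have k1_gt1 : 1 < k.-1 by rewrite -ltnS prednK // ltnW.
rewrite c2 -card_gt0 cC (ltnW k1_gt1) (gtn_eqF k1_gt1) !andbT /=; apply/eqP=> /setP/(_ (b x)).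
by rewrite !inE eqxx.
Qed.

End BlockMap.

(** * Comparison of two decompositions *)

Section TwoBlockMaps.
Variables (n k1 k2 : nat) (pi : 'S_n).
Variables (sigma1 : 'S_k1) (b1 : 'I_n -> 'I_k1).
Variables (sigma2 : 'S_k2) (b2 : 'I_n -> 'I_k2).
Hypotheses (bm1 : block_map pi sigma1 b1) (bm2 : block_map pi sigma2 b2).

(** A block of [b1] is an interval of [pi], not everything since [k1 > 1]; simplicity of [sigma2]
    confines it to one block of [b2]. *)
Lemma block_map_fiber s t : 1 < k1 -> 3 < k2 -> simple_perm sigma2 ->
  b1 s = b1 t -> b2 s = b2 t.
Proof.
move=> k1_gt1 k2_gt3 simple2 bst.
apply: (interval_sub_block bm2 k2_gt3 simple2 (interval_fiber bm1 (b1 t)));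
  rewrite ?inE ?bst //.
have [i ti] : exists i, i != b1 t.
  have : 0 < #|[set~ b1 t]| by rewrite cardsC1 card_ord -subn1 subn_gt0.
  by rewrite card_gt0 => /set0Pn[i]; rewrite !inE; exists i.
have [u bu] := (proj1 (proj1 bm1)) i.
by apply: contraNneq ti => /setP/(_ u); rewrite !inE bu.
Qed.

End TwoBlockMaps.

(** Each block of [b2] lies in a block of [b1], so a strict increase of [b1] forces one of [b2], and
    likewise for values. Exchanging the two maps will give equality. *)
Lemma block_map_leq n k1 k2 (pi : 'S_n)
    (sigma1 : 'S_k1) (b1 : 'I_n -> 'I_k1) (sigma2 : 'S_k2) (b2 : 'I_n -> 'I_k2) :
  block_map pi sigma1 b1 -> block_map pi sigma2 b2 ->
  3 < k1 -> 1 < k2 -> simple_perm sigma1 ->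
  (forall s, b1 s <= b2 s) /\ (forall s, sigma1 (b1 s) <= sigma2 (b2 s)).
Proof.
move=> bm1 bm2 k1_gt3 k2_gt1 simple1.
have fib s t : b2 s = b2 t -> b1 s = b1 t :=
  block_map_fiber bm2 bm1 k2_gt1 k1_gt3 simple1.
case: (bm1) (bm2) => -[onto1 mono1] val1 [[onto2 mono2] val2].
split; apply: onto_refine_leq => //.
- move=> s t lt1; case: (ltngtP (b2 s) (b2 t)) => // [/mono2|/val_inj/fib eq1].
    by rewrite ltnNge ltnW // mono1.
  by rewrite eq1 ltnn in lt1.
- move=> i; have [s bs] := onto1 ((sigma1^-1)%g i).
  by exists s; rewrite bs permKV.
- move=> s t lt1.
  case: (ltngtP (sigma2 (b2 s)) (sigma2 (b2 t))) => // [/val2|].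
    by rewrite ltnNge ltnW // val1.
  by move=> /val_inj/perm_inj/fib eq1; rewrite eq1 ltnn in lt1.
Qed.

(** * Inflations of a fixed shape and their number *)

Section Inflate.
Variables (k : nat) (sigma : 'S_k) (m : 'I_k -> nat).

(** With [sigma] and [m] fixed, the block offsets agree on both sides and cancel. *)
Lemma inflate_inj (alpha beta : forall i, 'S_(m i)) :
  inflate sigma alpha = inflate sigma beta -> forall i, alpha i = beta i.
Proof.
move=> eq_ab i; apply/permP=> j; apply: val_inj => /=.
by have := inflateE sigma alpha j; rewrite eq_ab inflateE => /addnI.
Qed.

Lemma inflate_block_map (alpha : forall i, 'S_(m i)) :
  (forall i, 0 < m i) ->
  block_map (inflate sigma alpha) sigma (@tagnat.sig1 k m).
Proof.
move=> m0; split; first split.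
- by move=> i; exists (tagnat.Rank i (Ordinal (m0 i))); rewrite tagnat.Rank1K.
- move=> s t; apply: contraTT; rewrite -!leqNgt; exact: tagnat.le_sig1.
- by move=> s t lt_st; rewrite !permE /= inflate_val_block.
Qed.

(** This recovers the sizes [m] from the block map alone. *)
Lemma card_sig1_fiber i : #|[set s | @tagnat.sig1 k m s == i]| = m i.
Proof.
have Rank_inj : injective (@tagnat.Rank k m i).
  by move=> j j' /eqP; rewrite -val_eqE tagnat.eq_Rank eqxx => /eqP/val_inj.
rewrite -[RHS]card_ord -cardsT -(card_imset _ Rank_inj).
apply: eq_card => s; rewrite inE; apply/eqP/imsetP => [<-|[j _ ->]].
  by exists (tagnat.sig2 s); rewrite ?tagnat.sig2K.
exact: tagnat.Rank1K.
Qed.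

End Inflate.

(** The size equation sits under the existential, so the set makes sense for every [n] and is empty
    when the sizes do not sum to [n]. *)
Definition blockwise_inflations n k (sigma : 'S_k) (m : 'I_k -> nat) :
    {set 'S_n} :=
  [set pi : 'S_n | `[< exists (e : \sum_(i < k) m i = n)
                             (alpha : forall i, 'S_(m i)),
     (forall i, blockwise_simple (alpha i)) /\
     pi = cast_perm e (inflate sigma alpha) >]].

Lemma card_blockwise_inflations n k (sigma : 'S_k) (m : 'I_k -> nat) :
  \sum_(i < k) m i = n ->
  #|blockwise_inflations n sigma m| = \prod_(i < k) num_blockwise_simple (m i).
Proof.
(* Eliminating [e] makes [n] the sum itself, so the casts below are trivial. *)
move=> e; case: _ / e.
pose W i := [set pi : 'S_(m i) | `[< blockwise_simple pi >]].
rewrite -(cardsXn W).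
rewrite -(card_imset (f := fun a : {dffun forall i, 'S_(m i)} => inflate sigma a)).
  apply: eq_card => pi; rewrite inE; apply/asboolP/imsetP.
    move=> [e [alpha [bws_alpha ->]]]; rewrite cast_perm_id.
    exists [ffun i => alpha i].
      by apply/setXnP => i; rewrite ffunE inE; apply/asboolP.
    by congr inflate; apply: functional_extensionality_dep => i; rewrite ffunE.
  move=> [a /setXnP Wa ->]; exists erefl, a; rewrite cast_perm_id; split=> // i.
  by have := Wa i; rewrite inE => /asboolP.
by move=> a b /inflate_inj eq_ab; apply/ffunP.
Qed.

(** * Uniqueness of the shape *)

Section Uniqueness.
Variables (n : nat) (pi : 'S_n).

Lemma blockwise_inflations_block_map k (sigma : 'S_k) (m : 'I_k -> nat) :
  (forall i, 0 < m i) -> pi \in blockwise_inflations n sigma m ->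
  exists2 b, block_map pi sigma b & forall i, #|[set s | b s == i]| = m i.
Proof.
move=> m0; rewrite inE => /asboolP[e [alpha [_]]].
case: _ / e pi => pi0 ->; rewrite cast_perm_id.
exists (@tagnat.sig1 k m); first exact: inflate_block_map.
exact: card_sig1_fiber.
Qed.

Lemma blockwise_inflations_size_leq k1 k2
    (sigma1 : 'S_k1) m1 (sigma2 : 'S_k2) m2 :
  3 < k1 -> 3 < k2 -> simple_perm sigma1 ->
  (forall i, 0 < m1 i) -> (forall i, 0 < m2 i) ->
  pi \in blockwise_inflations n sigma1 m1 ->
  pi \in blockwise_inflations n sigma2 m2 -> k1 <= k2.
Proof.
move=> k1_gt3 k2_gt3 simple1 m1_gt0 m2_gt0.
move=> /(blockwise_inflations_block_map m1_gt0)[b1 bm1 _].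
move=> /(blockwise_inflations_block_map m2_gt0)[b2 bm2 _].
have [le_b _] := block_map_leq bm1 bm2 k1_gt3 (ltnW (ltnW k2_gt3)) simple1.
have k1_gt0 : 0 < k1 by apply: leq_trans k1_gt3.
have k1P : k1.-1 < k1 by rewrite prednK.
(* A position in the last block of [b1] has [b2]-index at least [k1 - 1]. *)
have [s bs] := proj1 (proj1 bm1) (Ordinal k1P).
have := leq_ltn_trans (le_b s) (ltn_ord (b2 s)).
by rewrite bs /= prednK.
Qed.

Lemma blockwise_inflations_uniq k (sigma1 sigma2 : 'S_k) m1 m2 :
  3 < k -> simple_perm sigma1 -> simple_perm sigma2 ->
  (forall i, 0 < m1 i) -> (forall i, 0 < m2 i) ->
  pi \in blockwise_inflations n sigma1 m1 ->
  pi \in blockwise_inflations n sigma2 m2 -> sigma1 = sigma2 /\ m1 =1 m2.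
Proof.
move=> k_gt3 simple1 simple2 m1_gt0 m2_gt0.
move=> /(blockwise_inflations_block_map m1_gt0)[b1 bm1 card1].
move=> /(blockwise_inflations_block_map m2_gt0)[b2 bm2 card2].
have k_gt1 := ltnW (ltnW k_gt3).
have [le_b12 le_v12] := block_map_leq bm1 bm2 k_gt3 k_gt1 simple1.
have [le_b21 le_v21] := block_map_leq bm2 bm1 k_gt3 k_gt1 simple2.
have eq_b s : b1 s = b2 s by apply/val_inj/eqP; rewrite eqn_leq le_b12 le_b21.
split=> [|i]; last by rewrite -card1 -card2; apply: eq_card => s; rewrite !inE eq_b.
apply/permP=> i; have [s <-] := proj1 (proj1 bm1) i.
by rewrite {2}eq_b; apply/val_inj/eqP; rewrite eqn_leq le_v12 le_v21.
Qed.

End Uniqueness.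

(** * Summation over all shapes *)

Lemma blockwise_simple_inflation n (pi : 'S_n) : blockwise_simple pi ->
  n = 1 \/ exists k (sigma : 'S_k) (m : 'I_k -> nat),
    [/\ 3 < k, simple_perm sigma, forall i, 0 < m i &
        pi \in blockwise_inflations n sigma m].
Proof.
case=> [|k sigma m alpha k_gt3 simple_s m_gt0 bws]; [by left | right].
exists k, sigma, m; split=> //; rewrite inE; apply/asboolP.
by exists erefl, alpha; rewrite cast_perm_id.
Qed.

Lemma inflation_blockwise_simple n k (sigma : 'S_k) m (pi : 'S_n) :
  3 < k -> simple_perm sigma -> (forall i, 0 < m i) ->
  pi \in blockwise_inflations n sigma m -> blockwise_simple pi.
Proof.
move=> k_gt3 simple_s m_gt0; rewrite inE => /asboolP[e [alpha [bws ->]]].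
by case: _ / e; rewrite cast_perm_id; constructor.
Qed.

(** Positivity bounds the number of parts by [n], and each part is at most the sum; this moves
    arbitrary sizes into the finite type of [Comp]. *)
Lemma sum_parts_Comp n k (m : 'I_k -> nat) :
  (forall i, 0 < m i) -> \sum_(i < k) m i = n ->
  k <= n /\ exists2 lam, lam \in Comp n k & m = tnth lam.
Proof.
move=> m_gt0 sum_m; have le_m i : m i < n.+1.
  by rewrite ltnS -sum_m (bigD1 i) //= leq_addr.
split.
  by rewrite -sum_m -[leqLHS]muln1 -[k in k * _]card_ord -sum_nat_const leq_sum.
exists [tuple Ordinal (le_m i) | i < k]; last first.
  by apply: functional_extensionality_dep => i; rewrite tnth_mktuple.
rewrite inE; apply/andP; split.
  by apply/forallP=> i; rewrite tnth_mktuple; apply: m_gt0.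
apply/eqP; apply: etrans sum_m; apply: eq_bigr => i _.
by rewrite tnth_mktuple.
Qed.

Theorem mainTheorem2 :
  forall n : nat, 4 <= n ->
  num_blockwise_simple n =
  \sum_(4 <= l < n.+1)
    num_simple l *
    \sum_(lam in Comp n l) \prod_(i < l) num_blockwise_simple (tnth lam i).
Proof.
move=> n n_ge4.
pose J (l : 'I_n.+1) : finType := ('S_l * l.-tuple 'I_n.+1)%type.
pose Q (l : 'I_n.+1) (p : J l) := simple_perm p.1 && (p.2 \in Comp n l).
pose P (t : {l : 'I_n.+1 & J l}) := (3 < tag t) && Q (tag t) (tagged t).
(* Inadmissible triples get the empty set, so that the union runs over a whole finite type. *)
pose D (t : {l : 'I_n.+1 & J l}) : {set 'S_n} :=
  if P t then blockwise_inflations n (tagged t).1 (tnth (tagged t).2) else set0.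
have Comp_gt0 l (lam : l.-tuple 'I_n.+1) :
    lam \in Comp n l -> forall i, 0 < tnth lam i.
  by rewrite inE => /andP[/forallP].
have Comp_sum l (lam : l.-tuple 'I_n.+1) :
    lam \in Comp n l -> \sum_(i < l) tnth lam i = n.
  by rewrite inE => /andP[_ /eqP].
have disjD t1 t2 : t1 != t2 -> [disjoint D t1 & D t2].
  apply: contraNT => /pred0Pn[pi /andP[]] /=; rewrite /D.
  case: ifP => [|_]; last by rewrite in_set0.
  case: ifP => [|_]; last by rewrite in_set0.
  case: t1 t2 => [l1 [s1 lam1]] [l2 [s2 lam2]].
  rewrite /P /Q /=.
  move=> /and3P[l2_gt3 simple2 /Comp_gt0 gt0_2].
  move=> /and3P[l1_gt3 simple1 /Comp_gt0 gt0_1] D1 D2.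
  have e : l1 = l2.
    apply/val_inj/eqP; rewrite eqn_leq.
    rewrite (blockwise_inflations_size_leq _ _ simple1 gt0_1 gt0_2 D1 D2) //.
    exact: (blockwise_inflations_size_leq _ _ simple2 gt0_2 gt0_1 D2 D1).
  case: _ / e in s2 lam2 l2_gt3 simple2 gt0_2 D2 *.
  have [-> eq_lam] :=
    blockwise_inflations_uniq l1_gt3 simple1 simple2 gt0_1 gt0_2 D1 D2.
  by rewrite (_ : lam1 = lam2) //; apply: eq_from_tnth => i; apply/val_inj/eq_lam.
have -> : num_blockwise_simple n = #|\bigcup_t D t|.
  apply: eq_card => pi; rewrite inE; apply/asboolP/bigcupP.
    (* The base case has size 1, excluded by [n >= 4]. *)
    move=> /blockwise_simple_inflation[n1|]; first by rewrite n1 in n_ge4.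
    move=> [k [sigma [m [k_gt3 simple_s m_gt0 Dpi]]]].
    have sum_m : \sum_(i < k) m i = n by move: Dpi; rewrite inE => /asboolP[].
    have [k_le [lam Clam em]] := sum_parts_Comp m_gt0 sum_m; subst m.
    pose l : 'I_n.+1 := Ordinal (k_le : k < n.+1).
    exists (Tagged J (i := l) (sigma, lam)) => //.
    by rewrite /D /P /Q /= k_gt3 simple_s Clam.
  move=> [[l [s lam]] _]; rewrite /D; case: ifP => [|_]; last by rewrite in_set0.
  rewrite /P /Q /= => /and3P[l_gt3 simple_s /Comp_gt0 gt0].
  exact: inflation_blockwise_simple.
pose F (l : 'I_n.+1) (p : J l) :=
  \prod_(i < l) num_blockwise_simple (tnth p.2 i).
rewrite -sum1_card (partition_disjoint_bigcup _ (fun=> 1) disjD).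
rewrite (eq_bigr (fun t => if P t then F (tag t) (tagged t) else 0)); last first.
  move=> [l [s lam]] _; rewrite sum1_card /D.
  case: ifP; rewrite ?cards0 // => /and3P[_ _ /Comp_sum].
  exact: card_blockwise_inflations.
(* The sum over triples splits into one over [l] and one over pairs; expanding [num_simple] as a sum
   of ones gives the other side the same shape. *)
rewrite -big_mkcond -(sig_big_dep (fun l : 'I_n.+1 => 3 < l) Q F).
rewrite big_geq_mkord; apply: eq_bigr => l _.
rewrite /num_simple -sum1_card big_distrl /=.
rewrite (eq_bigl (fun s : 'S_l => simple_perm s)); last by move=> s; rewrite inE.
under [RHS]eq_bigr do rewrite mul1n.
by rewrite pair_big_dep.
Qed.
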